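(* Let $(M,A,f)$ be a Hom-associative algebra in $\mathcal{LM}$ over a field $K$ of characteristic $0$, and let $\theta:M\to A$, $\omega:A\otimes A\to A$, $\mu:A\otimes M\to M$, $\nu:M\otimes A\to M$ be linear maps. Then $(\omega,\mu,\nu,\theta)$ generates a $1$-parameter infinitesimal deformation of $(M,A,f)$ if and only if the following two conditions hold: (i) $(\omega,\mu,\nu,\theta)$ is a $2$-cocycle of $(M,A,f)$ with coefficients in the adjoint representation; (ii) $(M,A,\theta)$ is a Hom-associative algebra in $\mathcal{LM}$ with respect to the multiplication $\omega$ on $A$ and the left and right actions $\mu,\nu$ of $A$ on $M$ (and the same Hom-maps $\alpha$, $\alpha_M$).
   Context: A Hom-associative algebra $(A,\alpha)$ is a vector space $A$ with a bilinear multiplication and a linear map $\alpha:A\to A$ with $\alpha(x)(yz)=(xy)\alpha(z)$; Hom-associative algebras are always assumed multiplicative: $\alpha(xy)=\alpha(x)\alpha(y)$. A bimodule of $(A,\alpha)$ is a vector space $M$ with a linear map $\alpha_M:M\to M$ and bilinear left and right actions $x\cdot m$, $m\cdot x\in M$ such that for all $x,y\in A$, $m\in M$: $\alpha_M(x\cdot m)=\alpha(x)\cdot\alpha_M(m)$, $\alpha_M(m\cdot x)=\alpha_M(m)\cdot\alpha(x)$, $\alpha(x)\cdot(y\cdot m)=(xy)\cdot\alpha_M(m)$, $\alpha_M(m)\cdot(xy)=(m\cdot x)\cdot\alpha(y)$, $\alpha(x)\cdot(m\cdot y)=(x\cdot m)\cdot\alpha(y)$. A Hom-associative algebra $(M,A,f)$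 in $\mathcal{LM}$ consists of a Hom-associative algebra $(A,\alpha)$, a bimodule $(M,\alpha_M)$ of it, and a linear map $f:M\to A$ with $\alpha\circ f=f\circ\alpha_M$, $f(x\cdot m)=xf(m)$, $f(m\cdot x)=f(m)x$. For $\lambda\in K$ put $f_\lambda(m)=f(m)+\lambda\theta(m)$, $x\cdot_\lambda y=xy+\lambda\omega(x,y)$, $x\cdot_\lambda m=x\cdot m+\lambda\mu(x,m)$, $m\cdot_\lambda x=m\cdot x+\lambda\nu(m,x)$. The quadruple $(\omega,\mu,\nu,\theta)$ generates a $1$-parameter infinitesimal deformation of $(M,A,f)$ if, for all values of the parameter $\lambda$, $(M_\lambda,A_\lambda,f_\lambda)$ (the spaces $M$, $A$ with these operations and the same Hom-maps $\alpha_M,\alpha$) is a Hom-associative algebra in $\mathcal{LM}$. The quadruple is a $2$-cocycle with coefficients in the adjoint representation if it is compatible with the Hom-maps, i.e. $\alpha\omega(x,y)=\omega(\alpha(x),\alpha(y))$, $\alpha_M\mu(x,m)=\mu(\alpha(x),\alpha_M(m))$, $\alpha_M\nu(m,x)=\nu(\alpha_M(m),\alpha(x))$, $\alpha\theta=\theta\alpha_M$, and for all $x,y,z\in A$, $m\in M$: (1) $\theta(x\cdot m)+f(\mu(x,m))-x\theta(m)-\omega(x,f(m))=0$; (2) $\theta(m\cdot x)+f(\nu(m,x))-\omega(f(m),x)-\theta(m)x=0$; (3) $\alpha(x)\omega(y,z)+\omega(\alpha(x),yz)-\omega(xy,\alpha(z))-\omega(x,y)\alpha(z)=0$; (4) $\alpha(x)\cdot\mu(y,m)+\mu(\alpha(x),y\cdot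 m)-\omega(x,y)\cdot\alpha_M(m)-\mu(xy,\alpha_M(m))=0$; (5) $\alpha_M(m)\cdot\omega(x,y)+\nu(\alpha_M(m),xy)-\nu(m,x)\cdot\alpha(y)-\nu(m\cdot x,\alpha(y))=0$; (6) $\alpha(x)\cdot\nu(m,y)+\mu(\alpha(x),m\cdot y)-\nu(x\cdot m,\alpha(y))-\mu(x,m)\cdot\alpha(y)=0$. *)

(* Defs.v *)
From mathcomp Require Import all_boot all_algebra.

Set Implicit Arguments.
Unset Strict Implicit.
Unset Printing Implicit Defensive.

Import GRing.Theory.
Local Open Scope ring_scope.

(* Same content as [bilinear_for *:%R *:%R op]; that product of propositions
   does not live in Prop, so it cannot be a field of the records below. *)
Definition is_bilinear (K : fieldType) (U V W : lmodType K)
    (op : U -> V -> W) : Prop :=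
  (forall u, linear (op u)) /\ (forall v, linear (op^~ v)).

(* The structures are predicates on plain operations, with (bi)linearity among
   the axioms, so that they apply verbatim to the deformed operations. *)
Section HomAssociative.
Variables (K : fieldType) (A M : lmodType K).

Record hom_assoc_algebra (mul : A -> A -> A) (alpha : A -> A) : Prop := {
  haa_bilinear : is_bilinear mul;
  haa_linear : linear alpha;
  haa_mult : forall x y, alpha (mul x y) = mul (alpha x) (alpha y);
  haa_assoc : forall x y z, mul (alpha x) (mul y z) = mul (mul x y) (alpha z)
}.

Record hom_bimodule (mul : A -> A -> A) (alpha : A -> A)
    (lact : A -> M -> M) (ract : M -> A -> M) (alphaM : M -> M) : Prop := {
  hbm_linear : linear alphaM;
  hbm_lbilinear : is_bilinear lact;
  hbm_rbilinear : is_bilinear ract;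
  hbm_lmult : forall x m, alphaM (lact x m) = lact (alpha x) (alphaM m);
  hbm_rmult : forall m x, alphaM (ract m x) = ract (alphaM m) (alpha x);
  hbm_lassoc : forall x y m,
    lact (alpha x) (lact y m) = lact (mul x y) (alphaM m);
  hbm_rassoc : forall m x y,
    ract (alphaM m) (mul x y) = ract (ract m x) (alpha y);
  hbm_lrassoc : forall x m y,
    lact (alpha x) (ract m y) = ract (lact x m) (alpha y)
}.

Record hom_assoc_LM (mul : A -> A -> A) (alpha : A -> A)
    (lact : A -> M -> M) (ract : M -> A -> M) (alphaM : M -> M)
    (f : M -> A) : Prop := {
  halm_algebra : hom_assoc_algebra mul alpha;
  halm_bimodule : hom_bimodule mul alpha lact ract alphaM;
  halm_linear : linear f;
  halm_hom : forall m, alpha (f m) = f (alphaM m);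
  halm_lact : forall x m, f (lact x m) = mul x (f m);
  halm_ract : forall m x, f (ract m x) = mul (f m) x
}.

Definition deform_op (U V W : lmodType K) (op phi : U -> V -> W) (lambda : K)
  : U -> V -> W := fun u v => op u v + lambda *: phi u v.

Definition deform_map (U V : lmodType K) (g h : U -> V) (lambda : K)
  : U -> V := fun u => g u + lambda *: h u.

Definition generates_inf_deformation (mul : A -> A -> A) (alpha : A -> A)
    (lact : A -> M -> M) (ract : M -> A -> M) (alphaM : M -> M) (f : M -> A)
    (omega : A -> A -> A) (mu : A -> M -> M) (nu : M -> A -> M)
    (theta : M -> A) : Prop :=
  forall lambda : K,
    hom_assoc_LM (deform_op mul omega lambda) alpha
      (deform_op lact mu lambda) (deform_op ract nu lambda) alphaM
      (deform_map f theta lambda).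

Record two_cocycle (mul : A -> A -> A) (alpha : A -> A)
    (lact : A -> M -> M) (ract : M -> A -> M) (alphaM : M -> M) (f : M -> A)
    (omega : {bilinear A -> A -> A}) (mu : {bilinear A -> M -> M})
    (nu : {bilinear M -> A -> M}) (theta : {linear M -> A}) : Prop := {
  coc_omega_hom : forall x y, alpha (omega x y) = omega (alpha x) (alpha y);
  coc_mu_hom : forall x m, alphaM (mu x m) = mu (alpha x) (alphaM m);
  coc_nu_hom : forall m x, alphaM (nu m x) = nu (alphaM m) (alpha x);
  coc_theta_hom : forall m, alpha (theta m) = theta (alphaM m);
  coc_f_lact : forall x m,
    theta (lact x m) + f (mu x m) - mul x (theta m) - omega x (f m) = 0;
  coc_f_ract : forall m x,
    theta (ract m x) + f (nu m x) - omega (f m) x - mul (theta m) x = 0;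
  coc_mul : forall x y z,
    mul (alpha x) (omega y z) + omega (alpha x) (mul y z)
    - omega (mul x y) (alpha z) - mul (omega x y) (alpha z) = 0;
  coc_lact : forall x y m,
    lact (alpha x) (mu y m) + mu (alpha x) (lact y m)
    - lact (omega x y) (alphaM m) - mu (mul x y) (alphaM m) = 0;
  coc_ract : forall m x y,
    ract (alphaM m) (omega x y) + nu (alphaM m) (mul x y)
    - ract (nu m x) (alpha y) - nu (ract m x) (alpha y) = 0;
  coc_lract : forall x m y,
    lact (alpha x) (nu m y) + mu (alpha x) (ract m y)
    - nu (lact x m) (alpha y) - ract (mu x m) (alpha y) = 0
}.

End HomAssociative.

(* Main.v *)
Require Import Defs.
From mathcomp Require Import all_boot all_algebra.

Set Implicit Arguments.
Unset Strict Implicit.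
Unset Printing Implicit Defensive.

Import GRing.Theory.
Local Open Scope ring_scope.

(** Each axiom of a Hom-associative algebra in LM is either linear in the
    operations [mul], [lact], [ract], [f] (bilinearity, linearity and
    compatibility with the Hom-maps) or compares two compositions of two of
    them (associativity, the bimodule axioms, equivariance of [f]).

    After substituting the deformed operations, an axiom of the first kind
    becomes affine in lambda: its constant term holds because [(M, A, f)] is
    an algebra in LM, so it holds for all lambda iff the same axiom holds for
    the quadruple.  An axiom of the second kind becomes quadratic in lambda:
    the constant term is again the axiom for the original structure, the
    linear term is the cocycle equation, and the quadratic term is the axiom
    for the quadruple.  A quadratic identity that holds at lambda = 1 and
    lambda = -1 and whose constant terms agree has equal linear and quadratic
    terms as soon as 2 is invertible, so the deformation identity splits into
    the cocycle equation and the axiom for the quadruple.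

    Fixing one argument of a bilinear operation turns each composition into
    an ordinary deformed linear map evaluated at an affine function of lambda;
    hence all six quadratic axioms are instances of the single equivalence
    [deform_comp_eqP]. *)

Lemma pchar0_two_neq0 (K : fieldType) : [pchar K] =i pred0 -> 2 != 0 :> K.
Proof. by move=> charK0; rewrite ((pcharf0P K).1 charK0). Qed.

Section Deformation.
Variable K : fieldType.

(** The values at 1 and -1 suffice: their sum is twice the quadratic
    coefficient and their difference twice the linear one. *)
Lemma quad_poly_eq0 (V : lmodType K) (v1 v2 : V) : 2 != 0 :> K ->
  (forall l : K, l *: v1 + l ^+ 2 *: v2 = 0) -> v1 = 0 /\ v2 = 0.
Proof.
move=> two_neq0 vanish.
have at1 : v1 + v2 = 0 by have := vanish 1; rewrite expr1n !scale1r.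
have atN1 : v2 = v1.
  have := vanish (-1); rewrite sqrrN expr1n scale1r scaleN1r addrC.
  by move/subr0_eq.
have : 2 *: v1 == 0 by rewrite scaler_nat mulr2n -{2}atN1 at1.
by rewrite scaler_eq0 (negPf two_neq0) atN1 => /eqP->.
Qed.

Lemma deform_map_linear (U V : lmodType K) (g h : U -> V) (l : K) :
  linear g -> linear h -> linear (deform_map g h l).
Proof.
move=> linear_g linear_h a u v; rewrite /deform_map linear_g linear_h.
by rewrite !scalerDr !scalerA addrACA mulrC.
Qed.

Lemma deform_op_bilinear (U V W : lmodType K) (op phi : U -> V -> W) (l : K) :
  is_bilinear op -> is_bilinear phi -> is_bilinear (deform_op op phi l).
Proof.
move=> [op_r op_l] [phi_r phi_l].
by split=> [u|v]; [exact: (deform_map_linear l (op_r u) (phi_r u))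
                  |exact: (deform_map_linear l (op_l v) (phi_l v))].
Qed.

Lemma bilinear_is_bilinear (U V W : lmodType K) (op : {bilinear U -> V -> W}) :
  is_bilinear op.
Proof. by split=> [u|v] a x y; [exact: linearPr | exact: linearPl]. Qed.

(** The affine axioms: [v0] and [w0] are the two sides for the original
    structure, [v1] and [w1] those for the deforming one. *)
Lemma deform_hom_eqP (U V : lmodType K) (a : U -> V) (v0 v1 : U) (w0 w1 : V) :
    linear a -> a v0 = w0 ->
  (forall l : K, a (v0 + l *: v1) = w0 + l *: w1) <-> a v1 = w1.
Proof.
move=> linear_a a_v0.
have expand l : a (v0 + l *: v1) = w0 + l *: a v1.
  by rewrite addrC linear_a a_v0 addrC.
split=> [/(_ 1)|a_v1 l]; rewrite expand ?a_v1 //.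
by rewrite !scale1r => /addrI.
Qed.

Lemma deform_map_affine (U V : lmodType K) (g h : U -> V) (l : K) (v0 v1 : U) :
    linear g -> linear h ->
  deform_map g h l (v0 + l *: v1)
    = g v0 + (l *: (g v1 + h v0) + l ^+ 2 *: h v1).
Proof.
move=> linear_g linear_h; rewrite /deform_map [v0 + _]addrC linear_g linear_h.
rewrite !scalerDr scalerA -expr2 -!addrA addrCA; congr (_ + (_ + _)).
exact: addrC.
Qed.

(** The quadratic axioms: both sides are a deformed linear map evaluated at a
    deformed element, so the coefficients of [l] and [l ^+ 2] are compared. *)
Lemma deform_comp_eqP (P Q T : lmodType K) (g h : P -> T) (g' h' : Q -> T)
    (p0 p1 : P) (q0 q1 : Q) : 2 != 0 :> K ->
    linear g -> linear h -> linear g' -> linear h' -> g p0 = g' q0 ->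
  (forall l : K, deform_map g h l (p0 + l *: p1)
                 = deform_map g' h' l (q0 + l *: q1))
  <-> g p1 + h p0 - h' q0 - g' q1 = 0 /\ h p1 = h' q1.
Proof.
move=> two_neq0 linear_g linear_h linear_g' linear_h' eq0.
have expand l : deform_map g h l (p0 + l *: p1)
    - deform_map g' h' l (q0 + l *: q1)
  = l *: (g p1 + h p0 - h' q0 - g' q1) + l ^+ 2 *: (h p1 - h' q1).
  rewrite !deform_map_affine // eq0 opprD addrACA subrr add0r opprD addrACA.
  by rewrite -!scalerBr opprD [- g' _ - _]addrC !addrA.
split=> [deform_eq|[coc_eq quad_eq] l].
  have vanish l : l *: (g p1 + h p0 - h' q0 - g' q1)
      + l ^+ 2 *: (h p1 - h' q1) = 0 by rewrite -expand deform_eq subrr.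
  by have [-> /subr0_eq->] := quad_poly_eq0 two_neq0 vanish.
by apply: subr0_eq; rewrite expand coc_eq quad_eq subrr !scaler0 addr0.
Qed.

End Deformation.

Theorem theorem5p1 (K : fieldType) (charK0 : [pchar K] =i pred0)
    (A M : lmodType K) (mul : A -> A -> A) (alpha : A -> A)
    (lact : A -> M -> M) (ract : M -> A -> M) (alphaM : M -> M) (f : M -> A)
    (MAf : hom_assoc_LM mul alpha lact ract alphaM f)
    (omega : {bilinear A -> A -> A}) (mu : {bilinear A -> M -> M})
    (nu : {bilinear M -> A -> M}) (theta : {linear M -> A}) :
  generates_inf_deformation mul alpha lact ract alphaM f omega mu nu theta
  <-> two_cocycle mul alpha lact ract alphaM f omega mu nu theta
      /\ hom_assoc_LM omega alpha mu nu alphaM theta.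
Proof.
have two_neq0 := pchar0_two_neq0 charK0.
case: MAf => -[mul_bil alpha_lin mul_mult mul_assoc].
case=> alphaM_lin lact_bil ract_bil lmult rmult lassoc rassoc lrassoc.
move=> f_lin f_hom f_lact f_ract.
have omega_bil := bilinear_is_bilinear omega.
have mu_bil := bilinear_is_bilinear mu.
have nu_bil := bilinear_is_bilinear nu.
have theta_lin : linear theta by exact: linearP.
have [mul_r mul_l] := mul_bil; have [omega_r omega_l] := omega_bil.
have [lact_r lact_l] := lact_bil; have [mu_r mu_l] := mu_bil.
have [ract_r ract_l] := ract_bil; have [nu_r nu_l] := nu_bil.
have omega_homP x y := deform_hom_eqP (omega x y) (omega (alpha x) (alpha y))
  alpha_lin (mul_mult x y).
have mu_homP x m := deform_hom_eqP (mu x m) (mu (alpha x) (alphaM m))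
  alphaM_lin (lmult x m).
have nu_homP m x := deform_hom_eqP (nu m x) (nu (alphaM m) (alpha x))
  alphaM_lin (rmult m x).
have theta_homP m := deform_hom_eqP (theta m) (theta (alphaM m))
  alpha_lin (f_hom m).
(* The outer bilinear operation of a composition is read as a map of the
   argument that involves lambda: [op u] when that argument is the right one,
   [op^~ v] when it is the left one. *)
have assocP x y z := deform_comp_eqP (omega y z) (omega x y) two_neq0
  (mul_r (alpha x)) (omega_r (alpha x)) (mul_l (alpha z)) (omega_l (alpha z))
  (mul_assoc x y z).
have lassocP x y m := deform_comp_eqP (mu y m) (omega x y) two_neq0
  (lact_r (alpha x)) (mu_r (alpha x)) (lact_l (alphaM m)) (mu_l (alphaM m))
  (lassoc x y m).
have rassocP m x y := deform_comp_eqP (omega x y) (nu m x) two_neq0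
  (ract_r (alphaM m)) (nu_r (alphaM m)) (ract_l (alpha y)) (nu_l (alpha y))
  (rassoc m x y).
have lrassocP x m y := deform_comp_eqP (nu m y) (mu x m) two_neq0
  (lact_r (alpha x)) (mu_r (alpha x)) (ract_l (alpha y)) (nu_l (alpha y))
  (lrassoc x m y).
have f_lactP x m := deform_comp_eqP (mu x m) (theta m) two_neq0
  f_lin theta_lin (mul_r x) (omega_r x) (f_lact x m).
have f_ractP m x := deform_comp_eqP (nu m x) (theta m) two_neq0
  f_lin theta_lin (mul_l x) (omega_l x) (f_ract m x).
split=> [deform|[coc LM]].
  have omega_hom x y := (omega_homP x y).1
    (fun l => haa_mult (halm_algebra (deform l)) x y).
  have mu_hom x m := (mu_homP x m).1
    (fun l => hbm_lmult (halm_bimodule (deform l)) x m).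
  have nu_hom m x := (nu_homP m x).1
    (fun l => hbm_rmult (halm_bimodule (deform l)) m x).
  have theta_hom m := (theta_homP m).1 (fun l => halm_hom (deform l) m).
  have assoc x y z := (assocP x y z).1
    (fun l => haa_assoc (halm_algebra (deform l)) x y z).
  have lassoc' x y m := (lassocP x y m).1
    (fun l => hbm_lassoc (halm_bimodule (deform l)) x y m).
  have rassoc' m x y := (rassocP m x y).1
    (fun l => hbm_rassoc (halm_bimodule (deform l)) m x y).
  have lrassoc' x m y := (lrassocP x m y).1
    (fun l => hbm_lrassoc (halm_bimodule (deform l)) x m y).
  have f_lact' x m := (f_lactP x m).1 (fun l => halm_lact (deform l) x m).
  have f_ract' m x := (f_ractP m x).1 (fun l => halm_ract (deform l) m x).
  split; split=> //.
  - by move=> x m; rewrite [_ + f _]addrC addrAC (f_lact' x m).1.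
  - by move=> m x; rewrite [_ + f _]addrC (f_ract' m x).1.
  - by move=> x y z; exact: (assoc x y z).1.
  - by move=> x y m; rewrite addrAC (lassoc' x y m).1.
  - by move=> m x y; rewrite addrAC (rassoc' m x y).1.
  - by move=> x m y; exact: (lrassoc' x m y).1.
  - by split=> // x y z; exact: (assoc x y z).2.
  - split=> //.
    + by move=> x y m; exact: (lassoc' x y m).2.
    + by move=> m x y; exact: (rassoc' m x y).2.
    + by move=> x m y; exact: (lrassoc' x m y).2.
  - by move=> x m; exact: (f_lact' x m).2.
  - by move=> m x; exact: (f_ract' m x).2.
case: coc => omega_hom mu_hom nu_hom theta_hom coc1 coc2 coc3 coc4 coc5 coc6.
case: LM => -[_ _ _ omega_assoc].
case=> _ _ _ _ _ mu_assoc nu_assoc munu_assoc _ _ theta_mu theta_nu l.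
split.
- split=> //; first exact: deform_op_bilinear.
  + by move=> x y; apply: (omega_homP x y).2.
  + by move=> x y z; apply: (assocP x y z).2.
- split=> //; try exact: deform_op_bilinear.
  + by move=> x m; apply: (mu_homP x m).2.
  + by move=> m x; apply: (nu_homP m x).2.
  + by move=> x y m; apply: (lassocP x y m).2; rewrite addrAC coc4.
  + by move=> m x y; apply: (rassocP m x y).2; rewrite addrAC coc5.
  + by move=> x m y; apply: (lrassocP x m y).2.
- exact: deform_map_linear.
- by move=> m; apply: (theta_homP m).2.
- by move=> x m; apply: (f_lactP x m).2; rewrite addrAC [f _ + _]addrC coc1.
- by move=> m x; apply: (f_ractP m x).2; rewrite [f _ + _]addrC coc2.
Qed.
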